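(* Let $v\in\mathbb{N}\setminus\{1\}$ and let $h\colon\mathbb{N}_2\to\mathbb{R}_{\ge0}$ be a $v$-transitive light weight such that $v\in V(h)$. If $D_h(1)_1=+\infty$ then $A_{h,v}(1)_1=+\infty$.
   Context: $\mathbb{N}=\{1,2,\dots\}$, $\mathbb{N}_0=\{0,1,2,\dots\}$, and $\mathbb{N}_2=\{e\subset\mathbb{N}:|e|=2\}$. A weight is a map $h\colon\mathbb{N}_2\to\mathbb{C}$ (here with values in $\mathbb{R}_{\ge0}$). A walk of length $n\in\mathbb{N}_0$ is a tuple $w=\langle v_0,\dots,v_n\rangle$ of elements of $\mathbb{N}$ with $v_{i-1}\ne v_i$ for $i=1,\dots,n$; its weight is $h(w)=\prod_{i=1}^n h(\{v_{i-1},v_i\})$ (and $h(w)=1$ if $n=0$). For a set $W$ of walks, $h(W)$ denotes the sum of $\sum_{w\in W}h(w)$ when it converges absolutely. $W(n)$ is the set of walks of length $n$ with $v_0=1$. The weight $h$ is light if $\sum_{w\in W(n)}h(w)$ converges absolutely for every $n\in\mathbb{N}_0$. $V(h)$ is the set of vertices $u\in\mathbb{N}$ such that some walk starting at $1$ and ending at $u$ has nonzero weight. For $v\in\mathbb{N}\setminus\{1\}$, $h$ is $v$-transitive if there is a bijection $f\colon\mathbb{N}\to\mathbb{N}$ with $f(1)=v$ and $h(\{f(a),f(b)\})=h(\{a,b\})$ for all $\{a,b\}\in\mathbb{N}_2$. $A_{h,v}(x)=\sum_{n\ge0}h(W(v,n))x^n$, where $W(v,n)$ is the set of walks in $W(n)$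 visiting $v$; $D_h(x)=\sum_{n\ge0}h(W(n))x^n$. For $U(x)=\sum_{n\ge0}u_nx^n\in\mathbb{R}[[x]]$, $U(1)_1=+\infty$ means $\lim_{n\to\infty}\sum_{j=0}^nu_j=+\infty$. *)

(* Defs.v *)
From HB Require Import structures.
From mathcomp Require Import all_boot all_order all_algebra finmap.
From mathcomp Require Import all_classical all_reals all_analysis.

Set Implicit Arguments.
Unset Strict Implicit.
Unset Printing Implicit Defensive.

Import Order.TTheory GRing.Theory Num.Theory.
Import numFieldNormedType.Exports.

Local Open Scope classical_set_scope.
Local Open Scope ring_scope.

Definition vertex := {n : nat | (0 < n)%N}.

Definition vertex1 : vertex := exist _ 1%N isT.

Definition edge := {e : {fset vertex} | #|` e|%fset == 2%N}.

Definition weight (R : realType) := edge -> {nonneg R}.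

(** [pair_weight h a b] is $h(\{a,b\})$; the value [0] for [a = b] is a
    convention that plays no role, as consecutive vertices of a walk differ. *)
Definition pair_weight (R : realType) (h : weight R) (a b : vertex) : R :=
  if insub [fset a; b]%fset is Some e then (h e)%:num else 0.

(** A walk $\langle v_0,\dots,v_n\rangle$ is the sequence of its [n.+1]
    vertices, so its length is one less than its [size]. *)
Definition is_walk (n : nat) (w : seq vertex) : Prop :=
  size w = n.+1 /\
  forall i, (1 <= i <= n)%N -> nth vertex1 w i.-1 <> nth vertex1 w i.

Definition walk_weight (R : realType) (h : weight R) (w : seq vertex) : R :=
  \prod_(1 <= i < size w) pair_weight h (nth vertex1 w i.-1) (nth vertex1 w i).

Definition walks1 (n : nat) : set (seq vertex) :=
  [set w | is_walk n w /\ nth vertex1 w 0 = vertex1].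

Definition walks1_visiting (v : vertex) (n : nat) : set (seq vertex) :=
  [set w | walks1 n w /\ v \in w].

(** Weights are nonnegative, so the unordered sum is a supremum of finite
    sums; [fine] is only meaningful when the sum converges. *)
Definition set_weight (R : realType) (h : weight R) (S : set (seq vertex)) : R :=
  fine (\esum_(w in S) (walk_weight h w)%:E)%E.

Definition light (R : realType) (h : weight R) : Prop :=
  forall n : nat, summable (walks1 n) (fun w => (walk_weight h w)%:E).

Definition reachable (R : realType) (h : weight R) : set vertex :=
  [set u | exists n w,
    [/\ is_walk n w, nth vertex1 w 0 = vertex1, nth vertex1 w n = u
      & walk_weight h w <> 0]].

Definition transitive_at (R : realType) (v : vertex) (h : weight R) : Prop :=
  exists f : vertex -> vertex,
    [/\ bijective f, f vertex1 = v
      & forall a b : vertex, a <> b ->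
          pair_weight h (f a) (f b) = pair_weight h a b].

(** Formal power series over [R] are given by their coefficient sequences. *)
Definition series_D (R : realType) (h : weight R) : R^nat :=
  fun n => set_weight h (walks1 n).

Definition series_A (R : realType) (h : weight R) (v : vertex) : R^nat :=
  fun n => set_weight h (walks1_visiting v n).

(** The power series, evaluated at $x = 1$ by ordinary summation, is $+\infty$. *)
Definition infinite_at_one (R : realType) (u : R^nat) : Prop :=
  \sum_(0 <= j < n.+1) u j @[n --> \oo] --> +oo.

(* Main.v *)
Require Import Defs.
From mathcomp Require Import all_boot all_order all_algebra.
From mathcomp Require Import all_classical all_reals all_analysis.

(** Prefixing a fixed walk from [1] to [v] of length [k] and weight [c > 0] to
    the image of a walk from [1] under the automorphism [f] gives an injection
    from the walks of length [n] into the walks of length [k + n] visiting [v],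
    which multiplies weights by [c]. Hence the [k + n]-th coefficient of
    $A_{h,v}$ is at least [c] times the [n]-th coefficient of $D_h$. *)

Set Implicit Arguments.
Unset Strict Implicit.
Unset Printing Implicit Defensive.

Import Order.TTheory GRing.Theory Num.Theory.
Import numFieldNormedType.Exports.

Local Open Scope classical_set_scope.
Local Open Scope ring_scope.

Lemma esum_subset (R : realType) (T : choiceType) (S S' : set T)
    (a : T -> \bar R) :
  S `<=` S' -> ((\esum_(x in S) a x) <= \esum_(x in S') a x)%E.
Proof.
move=> SS'; apply: ereal_sup_le => _ [X [finX XS] <-].
by exists X => //; split=> //; exact: subset_trans SS'.
Qed.

(** After dividing by [c], it suffices to bound each finite partial sum of [a], and [c] distributes
    over a finite sum. *)
Lemma le_esumZl (R : realType) (T : choiceType) (S : set T) (a : T -> \bar R)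
    (c : R) : 0 < c -> (forall x, 0 <= a x)%E ->
  (c%:E * (\esum_(x in S) a x) <= \esum_(x in S) (c%:E * a x))%E.
Proof.
move=> c0 a0; rewrite muleC -lee_pdivlMr//.
apply: ge_ereal_sup => _ [X [finX XS] <-].
rewrite lee_pdivlMr// muleC ge0_mule_fsumr//.
by apply: esum_ge; exists X.
Qed.

(** If the partial sums of [u] exceed [M / c] from [N] on, those of [w] exceed [M] from [k + N]
    on. *)
Lemma infinite_at_one_shift (R : realType) (u w : R^nat) (c : R) (k : nat) :
  0 < c -> (forall n, 0 <= w n) -> (forall n, c * u n <= w (k + n)%N) ->
  infinite_at_one u -> infinite_at_one w.
Proof.
move=> c0 w0 uw /cvgryPge uoo; apply/cvgryPge => M.
have [N _ uN] := uoo (M / c).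
exists (k + N)%N => // n /= kNn.
have kn : (k <= n)%N := leq_trans (leq_addr _ _) kNn.
have /uN : (N <= n - k)%N by rewrite leq_subRL.
rewrite ler_pdivrMr// mulrC => /le_trans; apply.
(* The first [k] terms of [w] are dropped by nonnegativity; the others, shifted by [k], dominate
   those of [c * u] one by one. *)
rewrite big_distrr/= (big_cat_nat _ (leqW kn))//= ler_wpDl ?sumr_ge0//.
rewrite -[X in \sum_(X <= _ < _) w _]add0n big_addn subSn//.
by apply: ler_sum => i _; rewrite addnC.
Qed.

Section Walks.
Variables (R : realType) (h : weight R).

Lemma pair_weight_ge0 a b : 0 <= pair_weight h a b.
Proof. by rewrite /pair_weight; case: insub. Qed.

Lemma walk_weight_ge0 w : 0 <= walk_weight h w.
Proof. by apply: prodr_ge0 => i _; exact: pair_weight_ge0. Qed.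

Lemma walk_weightE n w : size w = n.+1 ->
  walk_weight h w =
  \prod_(0 <= i < n) pair_weight h (nth vertex1 w i) (nth vertex1 w i.+1).
Proof. by move=> sw; rewrite /walk_weight sw big_add1. Qed.

Lemma is_walkE n w : is_walk n w <->
  size w = n.+1 /\
  forall i, (i < n)%N -> nth vertex1 w i <> nth vertex1 w i.+1.
Proof.
split=> -[sw wP]; split=> // i.
  by move=> ilt; apply: (wP i.+1).
by case: i => // i /andP[_]; exact: wP.
Qed.

(** Since [fine] sends infinite values to 0, finiteness is what makes [set_weight] the true sum. *)
Lemma walks1_summable S n : light h -> S `<=` walks1 n ->
  (\esum_(w in S) (walk_weight h w)%:E)%E \is a fin_num.
Proof.
move=> hl SW; rewrite ge0_fin_numE; last first.
  by apply: esum_ge0 => w _; rewrite lee_fin walk_weight_ge0.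
apply: le_lt_trans (hl n).
apply: le_trans (esum_subset _ SW) _; apply: le_esum => w _.
by rewrite gee0_abs// lee_fin walk_weight_ge0.
Qed.

End Walks.

Section Gluing.
Variables (R : realType) (h : weight R) (v : vertex) (f : vertex -> vertex).
Hypotheses (f_inj : injective f) (f1 : f vertex1 = v).
Hypothesis hf : forall a b : vertex, a <> b ->
  pair_weight h (f a) (f b) = pair_weight h a b.
Variables (k : nat) (p : seq vertex).
Hypotheses (pW : walks1 k p) (pv : nth vertex1 p k = v).

Let sp : size p = k.+1. Proof. by case: pW => -[]. Qed.

(** [behead] removes [f vertex1], which is the vertex [v] where [p] already ends. *)
Definition glue (u : seq vertex) := p ++ behead (map f u).

Lemma size_glue n u : walks1 n u -> size (glue u) = (k + n).+1.
Proof. by move=> [[su _] _]; rewrite size_cat size_behead size_map su sp. Qed.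

Lemma nth_glue_l u i : (i <= k)%N -> nth vertex1 (glue u) i = nth vertex1 p i.
Proof. by move=> ik; rewrite nth_cat sp ltnS ik. Qed.

Lemma nth_glue_r n u i : walks1 n u -> (i <= n)%N ->
  nth vertex1 (glue u) (k + i) = f (nth vertex1 u i).
Proof.
move=> [[su _] u1] ile; case: i ile => [|i] ile.
  (* The junction, position [k], still lies in [p]; there [v] is also [f] of the first vertex of
     [u]. *)
  by rewrite addn0 nth_glue_l// pv u1 f1.
rewrite nth_cat sp ltnNge addnS ltnS leq_addr/= subSS addKn nth_behead.
by rewrite (nth_map vertex1)// su ltnS.
Qed.

(** The vertices from position [k] on spell out [map f u], which determines [u] because [f] is
    injective. *)
Lemma glue_inj n : set_inj (walks1 n) glue.
Proof.
move=> u u' /set_mem uW /set_mem u'W e.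
have [[su _] _] := uW; have [[su' _] _] := u'W.
apply: (@eq_from_nth _ vertex1); first by rewrite su su'.
move=> i; rewrite su ltnS => ile; apply: f_inj.
by rewrite -(nth_glue_r uW)// -(nth_glue_r u'W)// e.
Qed.

Lemma glue_walk n u : walks1 n u -> walks1_visiting v (k + n) (glue u).
Proof.
move=> uW; split; last first.
  by rewrite mem_cat -pv mem_nth ?sp.
have [[/is_walkE[_ pP] p1] [/is_walkE[_ uP] _]] := (pW, uW).
split; last by rewrite nth_glue_l.
apply/is_walkE; split; first exact: size_glue.
(* Both ends of an edge lie at positions at most [k], inside [p], or at positions at least [k],
   where the edge is the [f]-image of an edge of [u]. *)
move=> i ilt; have [ik|ki] := ltnP i k.
  by rewrite !nth_glue_l//; [exact: pP|exact: ltnW].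
rewrite -(subnKC ki) -addnS.
have jn : (i - k < n)%N by rewrite ltn_subLR.
by rewrite !(nth_glue_r uW)// 1?ltnW// => /f_inj; exact: uP.
Qed.

(** The product over edges splits at the junction, and [f] preserves the weight of each edge of
    [u]. *)
Lemma glue_weight n u : walks1 n u ->
  walk_weight h (glue u) = walk_weight h p * walk_weight h u.
Proof.
move=> uW; have [/is_walkE[su uP] _] := uW.
rewrite (walk_weightE h (size_glue uW)) (walk_weightE h sp) (walk_weightE h su).
rewrite (big_cat_nat _ (leq_addr n k))//=; congr (_ * _).
  by apply: eq_big_nat => i /andP[_ ik]; rewrite !nth_glue_l// ltnW.
rewrite -[X in \prod_(X <= _ < _) pair_weight _ (nth _ (glue _) _) _]add0n big_addn addKn.
apply: eq_big_nat => i /andP[_ ilt].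
rewrite addnC -addnS !(nth_glue_r uW)// 1?ltnW// hf//; exact: uP.
Qed.

Lemma glue_series n : light h -> 0 < walk_weight h p ->
  walk_weight h p * series_D h n <= series_A h v (k + n)%N.
Proof.
move=> hl p0; rewrite -lee_fin EFinM /series_D /series_A /set_weight.
have VW : walks1_visiting v (k + n) `<=` walks1 (k + n) by move=> w [].
rewrite !fineK ?(walks1_summable hl VW) ?(walks1_summable hl (@subset_refl _ _))//.
apply: le_trans (le_esumZl _ p0 _) _ => [w|].
  by rewrite lee_fin walk_weight_ge0.
have <- : ((\esum_(u in walks1 n) (walk_weight h (glue u))%:E) =
    \esum_(u in walks1 n) ((walk_weight h p)%:E * (walk_weight h u)%:E))%E.
  by apply: eq_esum => u uW; rewrite (glue_weight uW) EFinM.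
(* By injectivity the sum over [u] is a sum over the image of [glue], a set of walks visiting
   [v]. *)
rewrite -(@esum_image _ _ _ _ glue (fun w => (walk_weight h w)%:E) (@glue_inj n)).
by apply: esum_subset => _ [u uW <-]; exact: glue_walk.
Qed.

End Gluing.

Theorem theorem9 (R : realType) (v : vertex) (hv : v <> vertex1)
    (h : weight R) (htrans : transitive_at v h) (hlight : light h)
    (hvV : reachable h v) (hD : infinite_at_one (series_D h)) :
  infinite_at_one (series_A h v).
Proof.
have [f [/bij_inj f_inj f1 hf]] := htrans.
have [k [p [pW p1 pv /eqP pn0]]] := hvV.
have p0 : 0 < walk_weight h p by rewrite lt0r pn0 walk_weight_ge0.
apply: (@infinite_at_one_shift _ _ _ _ k p0 _ _ hD) => [n|n].
  apply: fine_ge0; apply: esum_ge0 => w _.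
  by rewrite lee_fin walk_weight_ge0.
exact: (glue_series f_inj f1 hf (conj pW p1) pv).
Qed.
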